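(* Fix a complex number $\omega$ with $|\omega|=1$ and $\omega^4\ne1$, and a positive real number $R$. Then there exists $p_0>1$ such that for every real $p$ with $1<p<p_0$, every complex number $z$ with $|z|\le R$ has continuum many expansions in base $q:=p\omega$.
   Context: For a complex number $q$ with $|q|>1$, an expansion of a complex number $z$ in base $q$ is a sequence $(c_k)_{k\ge1}$ with $c_k\in\{0,1\}$ such that $\sum_{k=1}^\infty c_k q^{-k}=z$. *)

(* Defs.v *)
From HB Require Import structures.
From mathcomp Require Import all_boot all_order all_algebra.
From mathcomp Require Import all_classical all_reals all_analysis.
From mathcomp Require Import complex.
Set Implicit Arguments.
Unset Strict Implicit.
Unset Printing Implicit Defensive.
Import Order.TTheory GRing.Theory Num.Theory.
Import numFieldNormedType.Exports.
Local Open Scope classical_set_scope.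
Local Open Scope ring_scope.
Local Open Scope complex_scope.

(* [c k] is the digit c_(k+1).  The topology used on R[i] is the norm topology
   it carries as the one-dimensional normed space R[i]^o. *)
Definition is_expansion (R : realType) (q z : R[i]) (c : nat -> bool) : Prop :=
  series (fun k => (c k)%:R / q ^+ k.+1 : R[i]^o) @ \oo --> (z : R[i]^o).

Definition expansions (R : realType) (q z : R[i]) : set (nat -> bool) :=
  [set c | is_expansion q z c].

(* Main.v *)
(** Writing [z_0 = z] and [z_(n+1) = q z_n - c_n], the digits [c] expand [z] in
    base [q] as soon as the remainders [z_n] stay bounded.  Since [w^2 <> 1],
    the geometric sums of [w] and [w^2] are bounded, which yields a length [L]
    such that for every [y] some [j < L] has [Re (w^j y) >= |y| / 4].  Cut the
    digits into blocks of length [2 L] and put exactly one digit 1 in each block,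
    at an aligned position: for [p] close to 1 this maps a disc of radius
    [rho = max (r, 4)] into itself.  The aligned position can be taken in
    either half of the block, so each block carries one free bit, readable from
    the digits; hence [2^nat] injects into the expansions of [z]. *)

Require Import Defs.
From HB Require Import structures.
From mathcomp Require Import all_boot all_order all_algebra.
From mathcomp Require Import all_classical all_reals all_analysis.
From mathcomp Require Import complex ring lra zify.
Import Order.TTheory GRing.Theory Num.Theory.
Import numFieldNormedType.Exports.
Import complex.ComplexField.Normc.
Local Open Scope classical_set_scope.
Local Open Scope ring_scope.
Local Open Scope complex_scope.
Local Open Scope card_scope.

Local Notation Re := (@complex.Re _).
Local Notation Im := (@complex.Im _).

(** * Modulus and real part of complex numbers *)

Lemma normcE (R : realType) (z : R[i]) : `|z| = (normc z)%:C.
Proof. by []. Qed.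

Lemma normc_ge0 (R : realType) (z : R[i]) : 0 <= normc z.
Proof. by case: z => a b; exact: sqrtr_ge0. Qed.

Lemma normc_sqr (R : realType) (z : R[i]) :
  normc z ^+ 2 = Re z ^+ 2 + Im z ^+ 2.
Proof. by case: z => a b; rewrite /= sqr_sqrtr// addr_ge0// sqr_ge0. Qed.

Lemma normcX (R : realType) (z : R[i]) n : normc (z ^+ n) = normc z ^+ n.
Proof.
by elim: n => [|n IH]; rewrite ?expr0 ?normc1// !exprS normcM IH.
Qed.

Lemma normc_real (R : realType) (x : R) : 0 <= x -> normc x%:C = x.
Proof. by move=> x0; rewrite /= expr0n addr0 sqrtr_sqr ger0_norm. Qed.

Lemma normc_gt0 (R : realType) (z : R[i]) : z != 0 -> 0 < normc z.
Proof.
move=> z0; rewrite lt_neqAle normc_ge0 andbT eq_sym.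
by apply: contra_neq z0; exact: eq0_normc.
Qed.

Lemma normr_Re_le (R : realType) (z : R[i]) : `|Re z| <= normc z.
Proof.
rewrite -(@ler_pXn2r _ 2)// ?nnegrE ?normc_ge0// normc_sqr real_normK ?num_real//.
by rewrite lerDl sqr_ge0.
Qed.

Lemma ReD (R : realType) (x y : R[i]) : Re (x + y) = Re x + Re y.
Proof. by case: x; case: y. Qed.

Lemma Re_sqr (R : realType) (z : R[i]) : Re (z ^+ 2) = 2 * Re z ^+ 2 - normc z ^+ 2.
Proof. by rewrite normc_sqr; case: z => a b; rewrite expr2 /=; ring. Qed.

Lemma normcB1_sqr (R : realType) (z : R[i]) :
  normc (z - 1) ^+ 2 = normc z ^+ 2 - 2 * Re z + 1.
Proof. by rewrite !normc_sqr; case: z => a b /=; ring. Qed.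

Lemma Re_scale (R : realType) (x : R) (z : R[i]) : Re (x%:C * z) = x * Re z.
Proof. by case: z => a b /=; rewrite mul0r subr0. Qed.

(** * Geometric sums and alignment of powers with the positive real axis *)

Lemma normc_geometric_sum (R : realType) (w : R[i]) n :
  normc w = 1 -> w != 1 -> normc (\sum_(i < n) w ^+ i) <= 2 / normc (w - 1).
Proof.
move=> w1 wn1; have d0 : 0 < normc (w - 1) by rewrite normc_gt0 // subr_eq0.
rewrite ler_pdivlMr// mulrC -normcM -subrX1.
apply: le_trans (le_normcD _ _) _.
by rewrite normcN normc1 normcX w1 expr1n.
Qed.

Lemma Re_geometric_sum (R : realType) (w y : R[i]) n :
  normc w = 1 -> w != 1 ->
  `|\sum_(i < n) Re (w ^+ i * y)| <= 2 / normc (w - 1) * normc y.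
Proof.
move=> w1 wn1.
rewrite -(big_morph _ (ReD R) (erefl : Re 0 = 0)) -mulr_suml.
apply: le_trans (normr_Re_le _ _) _.
by rewrite normcM ler_wpM2r ?normc_ge0// normc_geometric_sum.
Qed.

(* With [a i = Re (w ^ i y)] and [t = |y|], the sum of the [a i] is bounded and
   that of the [a i ^ 2] is [n t ^ 2 / 2] up to a bounded error, so
   [(t + a i) (t / 4 - a i)] is negative on average. *)
Lemma exists_aligned_power (R : realType) (w : R[i]) :
  normc w = 1 -> w ^+ 2 != 1 ->
  exists L : nat, forall y : R[i],
    exists2 j, (j < L)%N & normc y / 4 <= Re (w ^+ j * y).
Proof.
move=> w1 w21.
have wn1 : w != 1 by apply: contra_neq w21 => ->; rewrite expr1n.
have w2n : normc (w ^+ 2) = 1 by rewrite normcX w1 expr1n.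
pose A := 2 / normc (w - 1); pose B := 2 / normc (w ^+ 2 - 1).
have A0 : 0 <= A by rewrite divr_ge0// normc_ge0.
have B0 : 0 <= B by rewrite divr_ge0// normc_ge0.
(* With [4 * (A + B) < L], the main term [L t^2 / 4] beats the error terms, which add up to at most
   [(A + B) t^2]. *)
have := truncnS_gt (4 * (A + B)); set L := (Num.truncn _).+1 => LAB.
exists L => y; apply: contrapT => noj.
have lt_j (j : 'I_L) : Re (w ^+ j * y) < normc y / 4.
  by rewrite ltNge; apply/negP => h; apply: noj; exists j.
set t := normc y in lt_j.
have t_gt0 : 0 < t.
  have := lt_j ord0; rewrite expr0 mul1r => h; move: (normr_Re_le _ y).
  by rewrite -/t ler_norml => /andP[h1 _]; lra.
have sum_ge0 : 0 <= \sum_(j < L) (t + Re (w ^+ j * y)) * (t / 4 - Re (w ^+ j * y)).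
  apply: sumr_ge0 => j _; apply: mulr_ge0; last by rewrite subr_ge0 ltW.
  have := normr_Re_le _ (w ^+ j * y); rewrite normcM normcX w1 expr1n mul1r.
  by rewrite ler_norml -/t => /andP[h _]; lra.
have S1 := Re_geometric_sum _ w y L w1 wn1.
have S2 := Re_geometric_sum _ (w ^+ 2) (y ^+ 2) L w2n w21.
have sumE : \sum_(j < L) (t + Re (w ^+ j * y)) * (t / 4 - Re (w ^+ j * y)) =
    - (L%:R * (t ^+ 2 / 4)) - 3 / 4 * t * \sum_(j < L) Re (w ^+ j * y)
    - 2^-1 * \sum_(j < L) Re ((w ^+ 2) ^+ j * y ^+ 2).
  (* The square of [Re (w ^+ j * y)] is linearized by [2 (Re u)^2 = |u|^2 + Re (u^2)]. *)
  rewrite (eq_bigr (fun j : 'I_L => - (t ^+ 2 / 4) +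
     (- (3 / 4 * t)) * Re (w ^+ j * y) + (- 2^-1) * Re ((w ^+ 2) ^+ j * y ^+ 2))).
    rewrite !big_split /= -!mulr_sumr sumr_const card_ord -mulr_natl; ring.
  move=> j _; rewrite -exprM mulnC exprM -exprMn Re_sqr.
  rewrite normcM normcX w1 expr1n mul1r -/t; by field.
move: sum_ge0 S1 S2; rewrite sumE normcX -/t -/A -/B => sum_ge0.
rewrite !ler_norml => /andP[S1 _] /andP[S2 _].
have : L%:R * t ^+ 2 / 4 <= (A + B) * t ^+ 2.
  have : t * - (A * t) <= t * \sum_(i < L) Re (w ^+ i * y) by rewrite ler_pM2l.
  have : 0 <= A * t ^+ 2 by rewrite mulr_ge0// sqr_ge0.
  have : 0 <= B * t ^+ 2 by rewrite mulr_ge0// sqr_ge0.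
  lra.
have : 4 * (A + B) * t ^+ 2 < L%:R * t ^+ 2 by rewrite ltr_pM2r// exprn_gt0.
lra.
Qed.

(** * Remainders and convergence of expansions *)

(* The remainders of the expansion: [z = c_0/q + ... + c_(n-1)/q^n + z_n/q^n]. *)
Fixpoint orbit {R : realType} (q : R[i]) (c : nat -> bool) (z : R[i]) n : R[i] :=
  if n is m.+1 then q * orbit q c z m - (c m)%:R else z.

Lemma orbit_partial_sum (R : realType) (q z : R[i]) (c : nat -> bool) n : q != 0 ->
  z - \sum_(k < n) (c k)%:R / q ^+ k.+1 = orbit q c z n / q ^+ n.
Proof.
move=> q0; elim: n => [|n IH]; first by rewrite big_ord0 subr0 expr0 divr1.
rewrite big_ord_recr /= opprD addrA IH exprS.
have qn0 : q ^+ n != 0 by rewrite expf_neq0.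
by field; rewrite qn0 q0.
Qed.

Lemma orbitD (R : realType) (q z : R[i]) (c : nat -> bool) m n :
  orbit q c z (m + n) = orbit q (fun k => c (m + k)%N) (orbit q c z m) n.
Proof. by elim: n => [|n IH]; rewrite ?addn0// addnS /= IH. Qed.

Lemma eq_orbit (R : realType) (q z : R[i]) (c c' : nat -> bool) n :
  (forall k, (k < n)%N -> c k = c' k) -> orbit q c z n = orbit q c' z n.
Proof.
elim: n => //= n IH cc'; rewrite IH ?cc'// => k kn.
by apply: cc'; exact: ltnW.
Qed.

Lemma orbit_zero_digits (R : realType) (q z : R[i]) n :
  orbit q (fun=> false) z n = q ^+ n * z.
Proof.
by elim: n => [|n IH] /=; rewrite ?expr0 ?mul1r// IH subr0 mulrA -exprS.
Qed.

Lemma orbit_one_digit (R : realType) (q z : R[i]) j n :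
  orbit q (fun k => k == j) z (j.+1 + n) = q ^+ n * (q ^+ j.+1 * z - 1).
Proof.
rewrite orbitD /= eqxx (@eq_orbit _ _ _ _ (fun=> false)).
  by rewrite orbit_zero_digits exprS -mulrA
    (@eq_orbit _ _ z _ (fun=> false) j) ?orbit_zero_digits// => k /ltn_eqF.
by move=> k _; apply/eqP; lia.
Qed.

Lemma orbit_growth (R : realType) (q z : R[i]) (c : nat -> bool) n : 1 <= normc q ->
  normc (orbit q c z n) <= normc q ^+ n * (normc z + n%:R).
Proof.
move=> q1; elim: n => [|n IH] /=; first by rewrite expr0 mul1r addr0.
apply: le_trans (le_normcD _ _) _; rewrite normcM normcN.
have : normc ((c n)%:R : R[i]) <= 1 by case: (c n); rewrite ?normc1 ?normc0.
have : 1 <= normc q ^+ n.+1 by exact: exprn_ege1.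
have := ler_wpM2l (le_trans ler01 q1) IH; rewrite mulrA -exprS -natr1.
set Q := normc q ^+ n.+1; lra.
Qed.

(** After [n] digits the error is [z_n / q^n], of modulus at most [B / |q|^n]. *)
Lemma bounded_orbit_expansion (R : realType) (q z : R[i]) (c : nat -> bool)
    (B : R) :
  1 < normc q -> (forall n, normc (orbit q c z n) <= B) -> is_expansion q z c.
Proof.
move=> q1 hB.
have q0 : q != 0 by apply: contraTneq q1 => ->; rewrite normc0 ltr10.
have p0 : 0 < normc q := lt_trans ltr01 q1.
have B0 : 0 <= B := le_trans (normc_ge0 _ _) (hB 0%N).
(* The norm takes values in [R[i]], so [e] is a positive complex number; it is real and is replaced
   by its real part. *)
apply/cvgrPdist_le => e e0.
have eE : e = (Re e)%:C.
  by rewrite RRe_real// gtr0_real.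
have e0' : 0 < Re e by rewrite -ltcR -eE.
have : geometric B (normc q)^-1 @ \oo --> 0.
  by apply: cvg_geometric; rewrite gtr0_norm ?invr_gt0// invf_lt1.
move=> /cvgrPdist_le/(_ _ e0'); apply: filterS => n.
rewrite sub0r normrN /= ger0_norm; last first.
  by rewrite mulr_ge0// exprn_ge0// invr_ge0 ltW.
move=> hn; rewrite /series /= big_mkord orbit_partial_sum// normcE eE lecR.
apply: le_trans hn; rewrite normcM normcV normcX exprVn ler_wpM2r// invr_ge0.
by rewrite exprn_ge0// ltW.
Qed.

(** Inside a block the remainder can grow only by the crude bound of [orbit_growth], so control at
    block ends suffices. *)
Lemma bounded_blocks_expansion (R : realType) (q z : R[i]) (c : nat -> bool)
    N (rho : R) :
  (0 < N)%N -> 1 < normc q ->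
  (forall m, normc (orbit q c z (m * N)) <= rho) -> is_expansion q z c.
Proof.
move=> N0 q1 hrho.
apply: (@bounded_orbit_expansion _ _ _ _ (normc q ^+ N * (rho + N%:R)) q1) => n.
have rho0 : 0 <= rho := le_trans (normc_ge0 _ _) (hrho 0%N).
have nN : (n %% N <= N)%N by rewrite ltnW// ltn_mod.
rewrite (divn_eq n N) orbitD; apply: le_trans (orbit_growth _ _ _ _ _ (ltW q1)) _.
apply: ler_pM; rewrite ?exprn_ge0 ?addr_ge0 ?normc_ge0 ?ler0n//.
  by rewrite ler_weXn2l// ltW.
by rewrite lerD// ler_nat.
Qed.

(** * One block with a single digit 1 *)

(** Subtracting 1 from an aligned point lowers the squared modulus by about [t / 2 - 1], where
    [t = |z|]; near [t = rho] this pays for the expansion by powers of [p]. *)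
Lemma block_stays_in_disc (R : realType) (w z : R[i]) (p rho : R) j n :
  normc w = 1 -> 1 <= p -> 4 <= rho ->
  (p ^+ (j.+1 + n)) ^+ 2 * (rho ^+ 2 + 1) <= rho ^+ 2 + rho / 2 ->
  normc z <= rho -> normc z / 4 <= Re (w ^+ j.+1 * z) ->
  normc ((p%:C * w) ^+ n * ((p%:C * w) ^+ j.+1 * z - 1)) <= rho.
Proof.
move=> w1 p1 rho4 small zrho zw.
have p0 : 0 <= p by lra.
have t0 := normc_ge0 _ z; set t := normc z in t0 zrho zw.
rewrite -(@ler_pXn2r _ 2)// ?nnegrE ?normc_ge0//; last by lra.
rewrite normcM exprMn normcB1_sqr.
have -> : Re ((p%:C * w) ^+ j.+1 * z) = p ^+ j.+1 * Re (w ^+ j.+1 * z).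
  by rewrite exprMn -rmorphXn -mulrA Re_scale.
rewrite !(normcM, normcX) normc_real// w1 mulr1 -/t.
set a := p ^+ n; set b := p ^+ j.+1; set x := Re _ in zw *.
have a1 : 1 <= a by exact: exprn_ege1.
have b1 : 1 <= b by exact: exprn_ege1.
move: small; rewrite exprD -/a -/b => small.
have -> : a ^+ 2 * ((b * t) ^+ 2 - 2 * (b * x) + 1) =
   (b * a) ^+ 2 * t ^+ 2 - 2 * (a ^+ 2 * b) * x + a ^+ 2 by ring.
have ab1 : 1 <= a ^+ 2 * b by rewrite mulr_ege1// exprn_ege1.
have aP : a ^+ 2 <= (b * a) ^+ 2.
  by rewrite exprMn ler_peMl ?exprn_ge0 ?exprn_ege1//; lra.
have x0 : 0 <= x by lra.
have xx : x <= (a ^+ 2 * b) * x by rewrite ler_peMl.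
set P := (b * a) ^+ 2 in small aP *.
have P1 : 1 <= P by apply: le_trans aP; exact: exprn_ege1.
(* the bound [P t^2 - t / 2 + P] is convex in [t], hence maximal at the
   endpoints of [0, rho] *)
have chord : P * t ^+ 2 <= P * (rho * t).
  by rewrite ler_wpM2l//; [lra | rewrite expr2 ler_wpM2r].
suff : P * (rho * t) - t / 2 + P <= rho ^+ 2 by lra.
(* The endpoint inequalities at 0 and [rho], weighted by [rho - t] and [t]; their sum is the goal
   multiplied by [rho]. *)
have h : 0 <= (rho ^+ 2 - P) * (rho - t) by rewrite mulr_ge0//; nra.
have h' : 0 <= (rho ^+ 2 + rho / 2 - P * (rho ^+ 2 + 1)) * t.
  by rewrite mulr_ge0//; lra.
rewrite -(@ler_pM2r _ rho); last by lra.
nra.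
Qed.

Lemma exists_base_bound (R : realType) N (x : R) :
  1 < x -> exists2 p0 : R, 1 < p0 & forall p, 1 < p -> p < p0 -> p ^+ N <= x.
Proof.
move=> x1; have e0 : 0 < x - 1 by lra.
have /cvgrPdist_lt/(_ _ e0) : (fun p : R => p ^+ N) @ (1 : R) --> (1 ^+ N : R).
  exact: exprn_continuous.
rewrite expr1n => /nbhs_ballP[d /= d0 hd]; exists (1 + d); first by lra.
move=> p p1 pd; have : `|1 - p ^+ N| < x - 1.
  by apply: hd; rewrite /ball /= ltr_norml; apply/andP; split; lra.
by rewrite ltr_norml => /andP[h _]; lra.
Qed.

(** * Digit sequences coding free bits *)

Definition block_next {R : realType} (q : R[i]) N (J : bool -> R[i] -> nat) b s :=
  q ^+ (N - (J b s).+1) * (q ^+ (J b s).+1 * s - 1).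

(** Remainders at block ends are computed from the bits alone, so that the digits can be defined
    from them without circularity. *)
Fixpoint block_state {R : realType} (q : R[i]) N J (z : R[i]) (b : nat -> bool) m :=
  if m is m'.+1 then block_next q N J (b m') (block_state q N J z b m') else z.

(* Block [m] holds a single digit 1, at the position chosen by [J] from the
   free bit [b m] and the current remainder. *)
Definition block_digits {R : realType} (q : R[i]) N J z (b : nat -> bool)
    k : bool :=
  (k %% N)%N == J (b (k %/ N)%N) (block_state q N J z b (k %/ N)).

Lemma orbit_block_digits (R : realType) (q : R[i]) N J z b m :
  (forall b s, J b s < N)%N ->
  orbit q (block_digits q N J z b) z (m * N) = block_state q N J z b m.
Proof.
move=> JN; elim: m => //= m IH; rewrite mulSn addnC orbitD IH.
set s := block_state _ _ _ _ _ m.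
rewrite (@eq_orbit _ _ _ _ (fun k => k == J (b m) s)) => [|k kN].
  by rewrite -{1}(subnKC (JN (b m) s)) orbit_one_digit.
have N0 : (0 < N)%N by case: N kN {IH JN s}.
by rewrite /block_digits divnMDl// (divn_small kN) addn0 modnMDl modn_small.
Qed.

(** Equal digits have their 1 at the same place in block [m], and the half containing it reveals the
    bit, whatever the two states are. *)
Lemma block_digits_inj (R : realType) (q : R[i]) N L J z :
  (forall b s, J b s < N)%N -> (forall b s, (L <= J b s)%N = b) ->
  injective (block_digits q N J z).
Proof.
move=> JN JL b b' bb'; apply/funext => m.
have N0 : (0 < N)%N by apply: leq_ltn_trans (JN true z).
have := congr1 (@^~ (m * N + J (b m) (block_state q N J z b m))%N) bb'.
rewrite /block_digits /= divnMDl// modnMDl divn_small// modn_small// addn0 eqxx.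
move=> /esym/eqP e.
by have := JL (b m) (block_state q N J z b m); rewrite e JL.
Qed.

Lemma pow2_injects_expansions (R : realType) (w : R[i]) (r : R) :
  normc w = 1 -> w ^+ 2 != 1 ->
  exists2 p0 : R, 1 < p0 &
    forall p : R, 1 < p -> p < p0 -> forall z : R[i], normc z <= r ->
    exists2 f : (nat -> bool) -> (nat -> bool), injective f &
      forall b, is_expansion (p%:C * w) z (f b).
Proof.
move=> w1 w21; have [L hL] := exists_aligned_power R w w1 w21.
(* [rho >= 4] makes [rho / 2 > 1], so the threshold ratio for [p ^+ (N * 2)] below exceeds 1. *)
pose N := (L + L)%N; pose rho := Num.max r 4.
have rho4 : 4 <= rho by rewrite le_max lexx orbT.
have d0 : 0 < rho ^+ 2 + 1 by rewrite ltr_wpDl// sqr_ge0.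
have [|p0 p01 hp0] :=
  exists_base_bound R (N * 2) ((rho ^+ 2 + rho / 2) / (rho ^+ 2 + 1)).
  by rewrite ltr_pdivlMr// mul1r; lra.
exists p0 => // p p1 pp0 z zr.
have small : (p ^+ N) ^+ 2 * (rho ^+ 2 + 1) <= rho ^+ 2 + rho / 2.
  by rewrite -exprM -ler_pdivlMr// hp0.
have /choice[J hJ] (bs : bool * R[i]) : exists j, [/\ (j < N)%N,
    (L <= j)%N = bs.1 & normc bs.2 / 4 <= Re (w ^+ j.+1 * bs.2)].
  case: bs => -[] s /=; rewrite /N.
    (* Alignment is applied to a rotated [s]: by [w ^+ L.+1] for the second half of the block, by
       [w] for the first. *)
    have [j jL] := hL (w ^+ L.+1 * s).
    rewrite normcM normcX w1 expr1n mul1r mulrA -exprD addnS addnC => h.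
    by exists (L + j)%N; split; rewrite ?ltn_add2l ?leq_addr.
  have [j jL] := hL (w * s).
  rewrite normcM w1 mul1r mulrA -exprSr => h.
  by exists j; split; rewrite ?ltn_addl// leqNgt jL.
pose J' b s := J (b, s).
have JN b s : (J' b s < N)%N by case: (hJ (b, s)).
have JL b s : (L <= J' b s)%N = b by case: (hJ (b, s)).
have q_norm : normc (p%:C * w) = p by rewrite normcM w1 mulr1 normc_real//; lra.
exists (block_digits (p%:C * w) N J' z); first exact: block_digits_inj JN JL.
move=> b; apply: (@bounded_blocks_expansion _ _ _ _ N rho).
- exact: leq_ltn_trans (JN true z).
- by rewrite q_norm.
move=> m; rewrite orbit_block_digits//; elim: m => [|m IH] /=.
  by rewrite le_max zr.
have [_ _ align] := hJ (b m, block_state (p%:C * w) N J' z b m).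
apply: block_stays_in_disc => //; first exact: ltW.
by rewrite subnKC.
Qed.

(** * The cardinality of the continuum *)

Lemma set_inj_card_le (T U : Type) (A : set T) (B : set U) (f : T -> U) :
  set_fun A B f -> set_inj A f -> A #<= B.
Proof.
move=> fAB finj.
have /injfunPex[g] : exists2 f : T -> U, set_fun A B f & set_inj A f by exists f.
exact: inj_card_le g.
Qed.

(** A real is coded by its Dedekind cut over enumerated rationals. *)
Lemma reals_le_pow2 (R : realType) : [set: R] #<= [set: nat -> bool].
Proof.
apply: (@set_inj_card_le _ _ _ _ (fun (x : R) n =>
  if unpickle n is Some a then ratr a < x else false)) => //.
move=> x y _ _ /= fxy.
have lt_iff (a : rat) : (ratr a < x) = (ratr a < y).
  by have := congr1 (@^~ (pickle a)) fxy; rewrite pickleK.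
wlog xy : x y {fxy} lt_iff / x < y => [hwlog|].
  case: (ltgtP x y) => // h; first exact: hwlog.
  by apply/esym/hwlog => // a; rewrite lt_iff.
have [a] := rat_in_itvoo xy; rewrite in_itv /= => /andP[xa ay].
by have := lt_iff a; rewrite ay => /lt_trans/(_ xa); rewrite ltxx.
Qed.

(** Base 3 with digits 0 and 1 makes the limit injective: the tail after place [n] is at most half
    of [1 / 3 ^+ n]. *)
Definition ternary_sum (R : realType) (b : nat -> bool) n : R :=
  \sum_(k < n) (b k)%:R / 3 ^+ k.

Lemma ternary_sumS (R : realType) b n :
  ternary_sum R b n.+1 = ternary_sum R b n + (b n)%:R / 3 ^+ n.
Proof. exact: big_ord_recr. Qed.

Lemma ternary_sum_bound (R : realType) b m n :
  ternary_sum R b (m + n) <= ternary_sum R b m + 3 / 2 / 3 ^+ m.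
Proof.
(* Adding the largest possible tail gives a quantity nonincreasing in [n], which makes the induction
   work. *)
suff : ternary_sum R b (m + n) + 3 / 2 / 3 ^+ (m + n) <=
       ternary_sum R b m + 3 / 2 / 3 ^+ m.
  by apply: le_trans; rewrite lerDl divr_ge0// exprn_ge0.
elim: n => [|n]; first by rewrite addn0.
apply: le_trans; rewrite addnS ternary_sumS exprS invfM.
have : 0 <= (3 ^+ (m + n) : R)^-1 by rewrite invr_ge0 exprn_ge0.
set u := (3 ^+ (m + n))^-1 => u0; case: (b _) => /=; lra.
Qed.

Lemma ternary_sum_nondecreasing (R : realType) b m n : (m <= n)%N ->
  ternary_sum R b m <= ternary_sum R b n.
Proof.
move=> /subnKC <-; elim: (n - m)%N => [|k IH]; first by rewrite addn0.
apply: le_trans IH _; rewrite addnS ternary_sumS lerDl.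
by rewrite divr_ge0// exprn_ge0.
Qed.

Lemma pow2_le_reals (R : realType) : [set: nat -> bool] #<= [set: R].
Proof.
pose f b := sup (range (ternary_sum R b)).
have ubT b m : ubound (range (ternary_sum R b))
    (ternary_sum R b m + 3 / 2 / 3 ^+ m).
  move=> _ [n _ <-]; apply: le_trans (ternary_sum_bound _ _ _ n).
  by apply: ternary_sum_nondecreasing; rewrite leq_addl.
have f_lt (b b' : nat -> bool) n : (forall k, (k < n)%N -> b k = b' k) ->
    b n -> ~~ b' n -> f b' < f b.
  move=> eqb bn b'n.
  have eqT : ternary_sum R b n = ternary_sum R b' n.
    by apply: eq_bigr => k _; rewrite eqb.
  have u0 : 0 < (3 ^+ n : R)^-1 by rewrite invr_gt0 exprn_gt0.
  have le1 : f b' <= ternary_sum R b' n.+1 + 3 / 2 / 3 ^+ n.+1.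
    by apply: ge_sup => //; exists (ternary_sum R b' 0), 0%N.
  have le2 : ternary_sum R b n.+1 <= f b.
    apply: ub_le_sup; last by exists n.+1.
    by exists (ternary_sum R b 0 + 3 / 2 / 3 ^+ 0).
  move: le1 le2; rewrite !ternary_sumS bn (negbTE b'n) eqT exprS invfM /=; lra.
apply: (@set_inj_card_le _ _ _ _ f) => // b b' _ _ fbb'.
apply/eqP/negPn/negP => /eqP neq.
(* At the first difference of [b] and [b'], [f_lt] gives a strict inequality in one direction. *)
have /existsNP[k /eqP dk] : ~ (forall k, b k = b' k) by move=> /funext.
have := @ex_minnP (fun k => b k != b' k) (ex_intro _ k dk); case=> n bn nmin.
have eqb i : (i < n)%N -> b i = b' i.
  by move=> ni; apply/eqP/negPn/negP => /nmin; rewrite leqNgt ni.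
case bE : (b n); case b'E : (b' n); move: bn; rewrite bE b'E// => _.
  have := f_lt b b' n eqb; rewrite bE b'E fbb' ltxx => h.
  by have := h isT isT.
have := f_lt b' b n (fun i ni => esym (eqb i ni)); rewrite bE b'E fbb' ltxx => h.
by have := h isT isT.
Qed.

Theorem theorem5p1 (R : realType) (omega : R[i]) (r : R) :
  `|omega| = 1 -> omega ^+ 4 != 1 -> 0 < r ->
  exists2 p0 : R, 1 < p0 &
    forall p : R, 1 < p -> p < p0 ->
    forall z : R[i], `|z| <= r%:C ->
      expansions (p%:C * omega) z #= [set: R].
Proof.
move=> [w1] w41 r0.
have w21 : omega ^+ 2 != 1.
  by apply: contra_neq w41 => w2; rewrite -[4%N]/(2 * 2)%N exprM w2 expr1n.
have [p0 p01 hp0] := pow2_injects_expansions R omega r w1 w21.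
exists p0 => // p p1 pp0 z; rewrite normcE lecR => zr.
have [f finj fexp] := hp0 p p1 pp0 z zr.
(* Upper bound: all digit sequences inject into the reals. Lower bound: reals inject into bit
   sequences, and these into expansions. *)
apply: Cantor_Bernstein.
  apply: card_le_trans (pow2_le_reals R).
  exact: card_leT.
apply: card_le_trans (reals_le_pow2 R) _.
apply: (@set_inj_card_le _ _ _ _ f) => [b _|b b' _ _]; first exact: fexp.
exact: finj.
Qed.
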